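(* Let $v,w\in\mathfrak{S}_n$ satisfy $w=vs_1s_2\cdots s_{n-1}$ and $\ell(w)-\ell(v)=n-1$. For $1\le i<j\le n$, the permutation $wt_{i,j}$ is a coatom of $[v,w]$ if and only if $w(i)>w(j)$ and $w(p)>w(i)$ for every $i<p<j$. Moreover, there are exactly $n-1$ coatoms in $[v,w]$, and hence $Q_{v,w}$ is combinatorially equivalent to a cube.
   Context: $\mathfrak{S}_n$ is the symmetric group on $\{1,\dots,n\}$ with product given by composition $(uz)(k)=u(z(k))$, $t_{i,j}=(i,j)$ is the transposition swapping $i$ and $j$, $s_i=t_{i,i+1}$ are the simple transpositions, $\ell(\cdot)$ is the length with respect to them, and $\le$ is Bruhat order. For $v\le w$, $[v,w]=\{z\in\mathfrak{S}_n\mid v\le z\le w\}$; a coatom of $[v,w]$ is an element of $[v,w]$ covered by $w$. The Bruhat interval polytope $Q_{v,w}$ is the convex hull in $\mathbb{R}^n$ of the points $(z(1),\dots,z(n))$ for $z\in[v,w]$. Two polytopes are combinatorially equivalent if their face posets are isomorphic. *)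

(* Defs.v *)
From mathcomp Require Import all_boot all_order all_fingroup all_algebra.
From mathcomp Require Import all_classical reals convex.

Set Implicit Arguments.
Unset Strict Implicit.
Unset Printing Implicit Defensive.

Import Order.TTheory GRing.Theory Num.Theory.

Local Open Scope classical_set_scope.
Local Open Scope ring_scope.

(* The symmetric group of degree n + 1 is 'S_n.+1, acting on 0, ..., n instead
   of 1, ..., n + 1. *)

(* In fingroup, (z * u)%g k = u (z k), the opposite of [pmul]. *)
Definition pmul (n : nat) (u z : 'S_n) : 'S_n := (z * u)%g.

Lemma pmulE (n : nat) (u z : 'S_n) (k : 'I_n) : pmul u z k = u (z k).
Proof. by rewrite /pmul permM. Qed.

Definition simple_transp (n : nat) (i : 'I_n) : 'S_n.+1 :=
  tperm (widen_ord (leqnSn n) i) (lift ord0 i).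

Lemma simple_transpE (n : nat) (i : 'I_n) (a b : 'I_n.+1) :
  a = i :> nat -> b = i.+1 :> nat -> simple_transp i = tperm a b.
Proof. by move=> ea eb; congr tperm; apply: val_inj. Qed.

(* The word r = [:: i1; ...; ik] stands for s_i1 s_i2 ... s_ik, where products
   are compositions of permutations. *)
Definition word_perm (n : nat) (r : seq 'I_n) : 'S_n.+1 :=
  \big[@pmul n.+1/1%g]_(i <- r) simple_transp i.

Definition has_word (n : nat) (w : 'S_n.+1) (k : nat) : bool :=
  [exists r : k.-tuple 'I_n, word_perm r == w].

Lemma word_perm_cat (n : nat) (r1 r2 : seq 'I_n) :
  word_perm (r1 ++ r2) = pmul (word_perm r1) (word_perm r2).
Proof.
rewrite /word_perm /pmul; elim: r1 => [|i r IHr] /=.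
  by rewrite big_nil mulg1.
by rewrite !big_cons IHr mulgA.
Qed.

Lemma word_perm1 (n : nat) (i : 'I_n) : word_perm [:: i] = simple_transp i.
Proof. by rewrite /word_perm big_cons big_nil /pmul mul1g. Qed.

Lemma word_exists (n : nat) (w : 'S_n.+1) : exists k, has_word w k.
Proof.
suff [r <-] : exists r : seq 'I_n, word_perm r = w.
  by exists (size r); apply/existsP; exists (in_tuple r).
have tP d (i j : 'I_n.+1) : (j = i + d.+1 :> nat)%N ->
    exists r : seq 'I_n, word_perm r = tperm i j.
  elim: d j => [|d IHd] j ji.
    have lt_in : (i < n)%N by rewrite -ltnS -(addn1 i) -ji.
    exists [:: Ordinal lt_in]; rewrite word_perm1.
    by apply: simple_transpE; rewrite // ji addn1.
  have lt_kn : (i + d.+1 < n)%N by rewrite -ltnS -addnS -ji.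
  pose k : 'I_n.+1 := widen_ord (leqnSn n) (Ordinal lt_kn).
  have [r er] := IHd k erefl.
  exists ([:: Ordinal lt_kn] ++ r ++ [:: Ordinal lt_kn]).
  rewrite !word_perm_cat word_perm1 er.
  rewrite (@simple_transpE _ (Ordinal lt_kn) k j) //; last by rewrite ji addnS.
  rewrite /pmul -[X in (X * _ * _)%g]tpermV -mulgA -conjgE tpermJ tpermL tpermD //.
    by apply/eqP => /(congr1 val) /= /eqP; rewrite -[X in _ == X]addn0 eqn_add2l.
  by apply/eqP => /(congr1 val) /= /eqP; rewrite ji -[X in _ == X]addn0 eqn_add2l.
have [ts -> _] := prod_tpermP w.
elim: ts => [|[i j] ts [r er]]; first by exists [::]; rewrite /word_perm !big_nil.
have [s es] : exists s : seq 'I_n, word_perm s = tperm i j.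
  have [lt_ij | lt_ji | /val_inj ->] := ltngtP i j.
  - by apply: (tP (j - i).-1); rewrite prednK ?subn_gt0 // subnKC // ltnW.
  - rewrite tpermC; apply: (tP (i - j).-1).
    by rewrite prednK ?subn_gt0 // subnKC // ltnW.
  - by exists [::]; rewrite /word_perm big_nil tperm1.
by exists (r ++ s); rewrite word_perm_cat er es /pmul big_cons.
Qed.

Definition perm_length (n : nat) (w : 'S_n.+1) : nat := ex_minn (word_exists w).

Definition bruhat_step (n : nat) : rel 'S_n.+1 :=
  [rel u z | [exists i, exists j, z == pmul u (tperm i j)]
             && (perm_length u < perm_length z)%N].

Definition bruhat (n : nat) : rel 'S_n.+1 := connect (@bruhat_step n).

Definition bruhat_lt (n : nat) : rel 'S_n.+1 :=
  [rel u z | (u != z) && bruhat u z].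

Definition bruhat_covers (n : nat) (u z : 'S_n.+1) : bool :=
  bruhat_lt u z && ~~ [exists x, bruhat_lt u x && bruhat_lt x z].

Definition bruhat_interval (n : nat) (v w : 'S_n.+1) : {set 'S_n.+1} :=
  [set z | bruhat v z && bruhat z w]%SET.

Definition coatoms (n : nat) (v w : 'S_n.+1) : {set 'S_n.+1} :=
  [set z in bruhat_interval v w | bruhat_covers z w]%SET.

Definition convex_hull (R : realType) (V : lmodType R) (A : set V) : set V :=
  smallest (@convex_set R V) A.

(* Coordinates are shifted by one so that they range over 1, ..., n + 1. *)
Definition perm_point (R : realType) (n : nat) (z : 'S_n.+1) : 'rV[R]_n.+1 :=
  \row_k (z k).+1%:R.

Arguments perm_point R {n} z.

Definition bruhat_polytope (R : realType) (n : nat) (v w : 'S_n.+1) :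
    set 'rV[R]_n.+1 :=
  convex_hull (perm_point R @` [set` bruhat_interval v w]).

Arguments bruhat_polytope R {n} v w.

(* Taking c = 0 shows that P itself and the empty set are faces. *)
Definition faces (R : realType) (d : nat) (P : set 'rV[R]_d) :
    set (set 'rV[R]_d) :=
  [set F | exists (c : 'rV[R]_d) (b : R),
     (forall x, P x -> \sum_i c 0 i * x 0 i <= b) /\
     F = P `&` [set x | \sum_i c 0 i * x 0 i = b]].

Definition comb_equiv (R : realType) (d e : nat)
    (P : set 'rV[R]_d) (Q : set 'rV[R]_e) : Prop :=
  exists f : set 'rV[R]_d -> set 'rV[R]_e,
    set_bij (faces P) (faces Q) f /\
    (forall F G, faces P F -> faces P G -> (F `<=` G <-> f F `<=` f G)).

Definition cube (R : realType) (d : nat) : set 'rV[R]_d :=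
  [set x | forall i, 0 <= x 0 i <= 1].

Arguments cube R d : clear implicits.

(* Main.v *)
Require Import Defs.
From mathcomp Require Import all_boot all_order all_fingroup all_algebra.
From mathcomp Require Import all_classical reals interval_inference convex.
From mathcomp Require Import zify.

Set Implicit Arguments.
Unset Strict Implicit.
Unset Printing Implicit Defensive.

Import Order.TTheory GRing.Theory Num.Theory.

(** Positions and values are numbered from 0.

    Right multiplication by the Coxeter element rotates positions, so the
    one-line notation of w is that of v with its first letter moved to the end.
    Counting inversions, the length grows by n exactly when that letter is
    smaller than all others: v = 0 a_0 ... a_(n-1) and w = a_0 ... a_(n-1) 0.
    Hence each position i < n of w has a next smaller position j(i), the first
    one to the right that carries a smaller value. The condition on (i, j) in
    the theorem says that j = j(i), so it holds for n pairs.

    Coatoms. Bruhat order makes the numbers #{p < k : z p >= t} monotone in z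
    ([bruhat_rank_count]), and for t > 0 those of v at k + 1 are those of w at
    k ([rank_count_shift]). If a position p between i and j carries a value
    below w i, then w t_(i,j) has too few large values among its first p + 1
    positions to be above v ([interval_tperm_between]). Conversely w t_(i,j(i)) is a vertex of the cube
    found below, and it is one inversion short of w ([next_smaller_coatom]).

    The cube. For a set S of positions other than the last, run through the
    values in increasing order and, when the position p of the current value in
    w lies in S, exchange the contents of p and j(p). The resulting permutations
    [vertex w S] decrease in Bruhat order as S grows ([vertex_flip]), from w to
    v ([vertex_full]), so they all lie in [v, w]. Let A_p be the largest interval of positions ending
    at p on which w >= w p, and let B_p be the interval (p, j(p)]. Then

      sum of z over A_p <= sum of w over A_p,
      sum of z over B_p <= sum of v over B_p

    for all z in [v, w], by the monotone counts ([block_sum_valid],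
    [shifted_block_sum_valid]). At [vertex w S] the first is an equality exactly
    when p is not in S, the second exactly when p is in S ([vertex_block_sum],
    [vertex_shifted_block_sum]).

    These n pairs of opposite facets and 2^n vertices in an n-dimensional
    polytope determine its face lattice ([cface_cubical]). At each vertex the n
    edges to its neighbours span the directions of the affine hull, and every
    point of the polytope is the vertex plus a nonnegative combination of them. A linear
    functional that is maximal at that vertex among the 2^n vertices therefore
    attains its maximum over the polytope there, and the face that it cuts out
    is an intersection of the given facets. The standard cube is an instance of
    the same lemma, and two instances have isomorphic face posets
    ([cubical_faces_equiv]). *)

(** * Length and inversions *)

Lemma perm_val_neq n (w : 'S_n) (i j : 'I_n) : i != j -> (w i : nat) != w j.
Proof. by apply: contra => /eqP/val_inj/perm_inj->. Qed.

Definition inversions (n : nat) (w : 'S_n) : nat :=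
  \sum_(p < n) \sum_(q < n) ((p < q) && (w q < w p)).

Lemma double_sum_split2 n (F : 'I_n -> 'I_n -> nat) (i j : 'I_n) : i != j ->
  \sum_p \sum_q F p q =
  \sum_(p | (p != i) && (p != j)) \sum_(q | (q != i) && (q != j)) F p q +
  \sum_(p | (p != i) && (p != j)) (F p i + F i p + F p j + F j p) +
  (F i i + F i j + F j i + F j j).
Proof.
move=> ij; have S (G : 'I_n -> nat) :
    \sum_p G p = G i + G j + \sum_(p | (p != i) && (p != j)) G p.
  by rewrite (bigD1 i) //= (bigD1 j) ?addnA // eq_sym.
rewrite S (S (F i)) (S (F j)) (eq_bigr _ (fun p _ => S (F p))).
by rewrite !big_split /=; lia.
Qed.

(** Only pairs that meet {i, j} are affected; a third position p contributes
    exactly when it lies between i and j with its value between w j and w i,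
    and it then accounts for two inversions. *)
Lemma inversions_tperm n (w : 'S_n) (i j : 'I_n) : i < j -> w j < w i ->
  inversions w = inversions (pmul w (tperm i j)) +
    (2 * \sum_(p < n | (i < p < j) && (w j < w p < w i)) 1).+1.
Proof.
move=> ij wij; have ne : i != j by apply: contraTneq ij => ->; rewrite ltnn.
set t := tperm i j.
have -> : inversions (pmul w t) =
    \sum_(p < n) \sum_(q < n) ((t p < t q) && (w q < w p)).
  rewrite /inversions (reindex_inj (@perm_inj _ t)); apply: eq_bigr => p _.
  rewrite (reindex_inj (@perm_inj _ t)); apply: eq_bigr => q _.
  by rewrite !pmulE !tpermK.
rewrite /inversions !(double_sum_split2 _ ne).
have tD p : (p != i) && (p != j) -> t p = p.
  by case/andP=> pi pj; rewrite tpermD // eq_sym.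
rewrite /t tpermL tpermR -/t !ltnn ij wij (ltnNge j) (ltnW ij) /=.
have -> : \sum_(p < n | (i < p < j) && (w j < w p < w i)) 1 =
    \sum_(p | (p != i) && (p != j)) ((i < p < j) && (w j < w p < w i)).
  rewrite [in RHS]big_mkcond [in LHS]big_mkcond; apply: eq_bigr => p _.
  case: (eqVneq p i) => [->|_]; first by rewrite ltnn.
  by case: (eqVneq p j) => [->|_]; [rewrite ltnn andbF|case: ifP].
have -> : (w i < w j) = false by apply/negbTE; rewrite -leqNgt ltnW.
have -> : \sum_(p | (p != i) && (p != j)) \sum_(q | (q != i) && (q != j))
      ((p < q) && (w q < w p)) =
    \sum_(p | (p != i) && (p != j)) \sum_(q | (q != i) && (q != j))
      ((t p < t q) && (w q < w p)) :> nat.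
  by apply: eq_bigr => p /tD ->; apply: eq_bigr => q /tD ->.
rewrite big_distrr /= !addn0 addn1 !addnS -!addnA; congr (_ + _).+1.
rewrite addn0 -big_split /=.
apply: eq_bigr => p Dp; rewrite (tD p Dp); case/andP: Dp => p_i p_j.
have := perm_val_neq w p_i; have := perm_val_neq w p_j.
have : (p : nat) != i by []. have : (p : nat) != j by [].
case: (ltngtP p i); case: (ltngtP p j); case: (ltngtP (w p) (w i));
  case: (ltngtP (w p) (w j)) => //=; lia.
Qed.

Lemma pmul_tpermK n (w : 'S_n) (i j : 'I_n) :
  pmul (pmul w (tperm i j)) (tperm i j) = w.
Proof. by rewrite /pmul mulgA tperm2 mul1g. Qed.

Lemma inversions_tperm_lt n (w : 'S_n) (i j : 'I_n) : i < j ->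
  (inversions (pmul w (tperm i j)) < inversions w) = (w j < w i).
Proof.
move=> ij; have [wji|] := ltnP (w j) (w i).
  by rewrite (inversions_tperm ij wji) addnS ltnS leq_addr.
rewrite leq_eqVlt (negPf (perm_val_neq w _)) /= => [wij|]; last first.
  by apply: contraTneq ij => ->; rewrite ltnn.
apply/negbTE; rewrite -leqNgt ltnW // -[X in inversions X < _](pmul_tpermK w i j).
have wt : pmul w (tperm i j) j < pmul w (tperm i j) i by rewrite !pmulE tpermL tpermR.
by rewrite [X in _ < X](inversions_tperm ij wt) addnS ltnS leq_addr.
Qed.

Lemma inversions_simple_transp n (w : 'S_n.+1) (k : 'I_n) :
  w (lift ord0 k) < w (widen_ord (leqnSn n) k) ->
  inversions w = (inversions (pmul w (simple_transp k))).+1.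
Proof.
move=> wk; have lt_k : widen_ord (leqnSn n) k < lift ord0 k.
  by rewrite /= /bump leq0n.
rewrite (inversions_tperm lt_k wk) big1 ?addn1 // => p /andP[/andP[kp]].
by rewrite /= /bump leq0n add1n ltnS => /(leq_trans kp); rewrite ltnn.
Qed.

Lemma inversions_simple_transp_le n (w : 'S_n.+1) (k : 'I_n) :
  inversions (pmul w (simple_transp k)) <= (inversions w).+1.
Proof.
have lt_k : widen_ord (leqnSn n) k < lift ord0 k by rewrite /= /bump leq0n.
have [/inversions_simple_transp -> |] :=
    ltnP (w (lift ord0 k)) (w (widen_ord (leqnSn n) k)).
  exact: leqW (leqnSn _).
rewrite leq_eqVlt (negPf (perm_val_neq w _)) /= => [wij|]; last first.
  by apply: contraTneq lt_k => ->; rewrite ltnn.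
rewrite (@inversions_simple_transp _ (pmul w (simple_transp k)) k).
  by rewrite pmul_tpermK.
by rewrite !pmulE /simple_transp tpermL tpermR.
Qed.

Lemma word_perm_rcons n (r : seq 'I_n) k :
  word_perm (rcons r k) = pmul (word_perm r) (simple_transp k).
Proof. by rewrite -cats1 word_perm_cat word_perm1. Qed.

Lemma inversions1 n : @inversions n 1 = 0.
Proof.
rewrite /inversions big1 // => p _; rewrite big1 // => q _.
by rewrite !perm1; case: ltngtP.
Qed.

(** An increasing permutation satisfies p <= w p everywhere, and the two sides
    have the same sum. *)
Lemma no_descent_perm1 n (w : 'S_n.+1) :
  (forall k : 'I_n, w (widen_ord (leqnSn n) k) < w (lift ord0 k)) -> w = 1%g.
Proof.
move=> asc; have ge_w m : forall p : 'I_n.+1, p = m :> nat -> m <= w p.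
  elim: m => [//|m IHm] p pm.
  have lt_mn : m < n by rewrite -ltnS -pm.
  have -> : p = lift ord0 (Ordinal lt_mn) by apply: val_inj.
  exact: leq_ltn_trans (IHm (widen_ord (leqnSn n) (Ordinal lt_mn)) erefl) (asc _).
have := @leqif_sum _ predT (fun p : 'I_n.+1 => p == w p :> nat)
  (fun p => p) (fun p => w p).
move=> /(_ (fun p _ => leqif_eq (ge_w _ p erefl))) [_].
rewrite [X in _ == X](_ : _ = \sum_(p < n.+1) p); last first.
  by rewrite [RHS](reindex_inj (@perm_inj _ w)).
rewrite eqxx => /esym/forallP e.
by apply/permP => p; rewrite perm1; apply/val_inj/esym/eqP/(e p).
Qed.

(** A simple transposition changes the number of inversions by one, which
    bounds the length from below; removing descents one at a time produces a
    word of that size. *)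
Lemma perm_lengthE n (w : 'S_n.+1) : perm_length w = inversions w.
Proof.
have le_word (r : seq 'I_n) : inversions (word_perm r) <= size r.
  elim/last_ind: r => [|r k IHr]; first by rewrite /word_perm big_nil inversions1.
  rewrite word_perm_rcons size_rcons.
  exact: leq_trans (inversions_simple_transp_le _ _) _.
have ex_word m : forall u : 'S_n.+1, inversions u = m ->
    exists2 r : seq 'I_n, word_perm r = u & size r = m.
  elim: m => [|m IHm] u um.
    exists [::] => //; rewrite /word_perm big_nil; apply/esym/no_descent_perm1 => k.
    rewrite ltnNge leq_eqVlt; apply/norP; split.
      by apply: perm_val_neq; rewrite -val_eqE /= /bump leq0n neq_ltn ltnSn orbT.
    by apply/negP => /inversions_simple_transp; rewrite um.
  have [k wk|asc] := pickP (fun k : 'I_n => u (lift ord0 k) < u (widen_ord (leqnSn n) k)).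
    have := inversions_simple_transp wk; rewrite um => -[/esym/IHm[r er sr]].
    exists (rcons r k); last by rewrite size_rcons sr.
    by rewrite word_perm_rcons er pmul_tpermK.
  have u1 : u = 1%g.
    apply: no_descent_perm1 => k; rewrite ltnNge leq_eqVlt asc orbF.
    by apply: perm_val_neq; rewrite -val_eqE /= /bump leq0n neq_ltn ltnSn orbT.
  by move: um; rewrite u1 inversions1.
rewrite /perm_length; case: ex_minnP => k /existsP[r /eqP er] kmin.
have wk : inversions w <= k by rewrite -er -[leqRHS](size_tuple r) le_word.
apply/eqP; rewrite eqn_leq wk andbT.
have [s es ss] := ex_word _ w erefl; apply: kmin.
by rewrite -ss; apply/existsP; exists (in_tuple s); rewrite /= es.
Qed.

(** * Bruhat order and rank counts *)

Lemma bruhat_step_tperm n (w : 'S_n.+1) (i j : 'I_n.+1) : i < j -> w j < w i ->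
  bruhat_step (pmul w (tperm i j)) w.
Proof.
move=> ij wji; rewrite /bruhat_step /= !perm_lengthE inversions_tperm_lt // wji andbT.
by apply/existsP; exists i; apply/existsP; exists j; rewrite pmul_tpermK.
Qed.

Lemma bruhat_stepP n (u z : 'S_n.+1) : bruhat_step u z ->
  exists i j : 'I_n.+1, [/\ i < j, z j < z i & u = pmul z (tperm i j)].
Proof.
case/andP=> /existsP[i /existsP[j /eqP zE]]; rewrite !perm_lengthE => uz.
have uE : u = pmul z (tperm i j) by rewrite zE pmul_tpermK.
have [ij|ji|eij] := ltngtP i j.
- by exists i, j; split=> //; rewrite -inversions_tperm_lt // -uE.
- by exists j, i; rewrite tpermC; split=> //; rewrite -inversions_tperm_lt // tpermC -uE.
- by move: uz; rewrite uE (val_inj eij) tperm1 /pmul mul1g ltnn.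
Qed.

Lemma connect_homo (T : finType) (e : rel T) (f : T -> nat) x y :
  (forall a b, e a b -> f a <= f b) -> connect e x y -> f x <= f y.
Proof.
move=> fe /connectP[s]; elim: s x => [|a s IHs] x /=; first by move=> _ ->.
by case/andP=> /fe xa /IHs h /h; apply: leq_trans.
Qed.

Lemma bruhat_inversions n (u z : 'S_n.+1) : bruhat u z -> inversions u <= inversions z.
Proof.
by apply: connect_homo => a b /bruhat_stepP[i [j [ij zij ->]]];
  rewrite ltnW // inversions_tperm_lt.
Qed.

Lemma bruhat_lastP n (u z : 'S_n.+1) : bruhat u z -> u != z ->
  exists2 y, bruhat u y & bruhat_step y z.
Proof.
case/connectP=> s; elim/last_ind: s z => [|s y _] z /=; first by move=> _ ->; rewrite eqxx.
rewrite rcons_path last_rcons => /andP[us sy] -> _.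
by exists (last u s) => //; apply/connectP; exists s.
Qed.

Lemma bruhat_lt_inversions n (u z : 'S_n.+1) :
  bruhat_lt u z -> inversions u < inversions z.
Proof.
case/andP=> uz /bruhat_lastP/(_ uz)[y /bruhat_inversions uy].
case/bruhat_stepP=> i [j [ij zij yE]].
by apply: leq_ltn_trans uy _; rewrite yE inversions_tperm_lt.
Qed.

Definition rank_count n (z : 'S_n) (k t : nat) : nat :=
  \sum_(p < n) ((p < k) && (t <= z p)).

(** Each step moves a larger value to an earlier position. This is the easy half
    of the tableau criterion. *)
Lemma bruhat_rank_count n (u z : 'S_n.+1) k t : bruhat u z ->
  rank_count u k t <= rank_count z k t.
Proof.
apply: (connect_homo (f := fun x => rank_count x k t)) => a b.
case/bruhat_stepP=> i [j [ij bij ->]].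
have ne : i != j by apply: contraTneq ij => ->; rewrite ltnn.
rewrite /rank_count (bigD1 i) // [in leqRHS](bigD1 i) //=.
rewrite (bigD1 j) 1?eq_sym // [in leqRHS](bigD1 j) 1?eq_sym //=.
rewrite !pmulE tpermL tpermR !addnA; apply: leq_add; first by lia.
by apply: leq_sum => p /andP[p_i p_j]; rewrite pmulE tpermD // eq_sym.
Qed.

Definition block_count n (z : 'S_n) (a b t : nat) : nat :=
  \sum_(p < n | a <= p < b) (t <= z p).

Lemma rank_count_cat n (z : 'S_n) a b t : a <= b ->
  rank_count z b t = rank_count z a t + block_count z a b t.
Proof.
move=> ab; rewrite /block_count big_mkcond -big_split; apply: eq_bigr => p _.
by case: (ltnP p a) => /= [pa|pa]; [rewrite (leq_trans pa ab) addn0|case: (p < b)].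
Qed.

Lemma rank_count0 n (z : 'S_n) t : rank_count z 0 t = 0.
Proof. by rewrite /rank_count big1. Qed.

Lemma rank_countS n (z : 'S_n) (q : 'I_n) t :
  rank_count z q.+1 t = rank_count z q t + (t <= z q).
Proof.
rewrite (rank_count_cat z t (leqnSn q)); congr (_ + _).
by rewrite /block_count (big_pred1 q) // => p; rewrite ltnS -eqn_leq eq_sym.
Qed.

Definition block_sum n (z : 'S_n) (a b : nat) : nat := \sum_(p < n | a <= p < b) z p.

Lemma block_sum_count n (z : 'S_n.+1) a b :
  block_sum z a b = \sum_(t < n) block_count z a b t.+1.
Proof.
rewrite /block_count exchange_big /=; apply: eq_bigr => p _.
have := ltn_ord (z p); rewrite ltnS; move: (nat_of_ord _) => x {z a b p}.
elim: n => [|n IHn]; first by rewrite leqn0 big_ord0 => /eqP.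
rewrite leq_eqVlt big_ord_recr /= => /orP[/eqP->|].
  rewrite ltnSn (eq_bigr (fun=> 1)) ?sum1_card ?card_ord ?addn1 // => t _.
  by rewrite ltnW ?ltnS.
by rewrite ltnS => xn; rewrite -IHn // ltnNge xn addn0.
Qed.

(** * The Coxeter element *)

(** The product of the first k simple transpositions rotates the positions
    0, ..., k. *)
Lemma bigpmul_simple_transp n (p : 'I_n.+1) :
  (\big[@pmul n.+1/1%g]_(i < n) simple_transp i) p =
    (if p == ord_max then 0 else p.+1) :> nat.
Proof.
have pref k : k <= n -> forall p : 'I_n.+1,
    word_perm (take k (enum 'I_n)) p =
      (if p < k then p.+1 else if p == k :> nat then 0 else p) :> nat.
  elim: k => [_ {}p|k IHk kn {}p].
    rewrite take0 /word_perm big_nil perm1; by case: eqP.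
  rewrite (take_nth (Ordinal kn)) ?size_enum_ord // word_perm_rcons pmulE.
  set s := nth _ _ _.
  have sk : s = k :> nat by rewrite /s nth_enum_ord.
  rewrite (IHk (ltnW kn)) /simple_transp.
  case: tpermP => [->|->|/eqP p1 /eqP p2] /=; rewrite /bump ?sk ?leq0n ?add1n.
  - by do !case: ifP => //; lia.
  - by do !case: ifP => //; lia.
  have {}p1 : (p : nat) != k by rewrite -sk.
  have {}p2 : (p : nat) != k.+1.
    by apply: contra p2; rewrite -val_eqE /= /bump sk leq0n add1n.
  rewrite ltnS (leq_eqVlt p k) (negPf p1) (negPf p2) /=; by case: ltnP.
have := pref n (leqnn n) p; rewrite take_oversize ?size_enum_ord // => {pref}.
rewrite /word_perm enumT [index_enum _]unlock => ->.
have -> : (p == ord_max) = (p == n :> nat) by rewrite -val_eqE.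
by have := ltn_ord p; rewrite ltnS; case: ltngtP.
Qed.

(** The inversions of v and w that avoid the moved letter correspond. The others
    number #{p : v 0 < v p} for w and #{p : v p < v 0} for v; these add up to n,
    so a difference of n forces the second to vanish. *)
Lemma first_value_min n (v w : 'S_n.+1) :
  (forall p : 'I_n, w (widen_ord (leqnSn n) p) = v (lift ord0 p)) ->
  w ord_max = v ord0 -> inversions w = inversions v + n -> v ord0 = ord0.
Proof.
move=> wv wmax.
have -> : inversions w = \sum_(p < n) \sum_(q < n)
      ((p < q) && (w (widen_ord (leqnSn n) q) < v (lift ord0 p))) +
    \sum_(p < n) (v ord0 < v (lift ord0 p)).
  rewrite /inversions big_ord_recr /= [X in _ + X]big1 ?addn0 => [|q _]; last first.
    by rewrite ltnNge -ltnS ltn_ord.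
  rewrite -big_split; apply: eq_bigr => p _.
  by rewrite big_ord_recr /= wv wmax ltn_ord.
have -> : inversions v = \sum_(p < n) (v (lift ord0 p) < v ord0) +
    \sum_(p < n) \sum_(q < n)
      ((bump 0 p < bump 0 q) && (v (lift ord0 q) < v (lift ord0 p))).
  rewrite /inversions big_ord_recl big_ord_recl /= add0n; congr (_ + _).
  by apply: eq_bigr => p _; rewrite big_ord_recl /= add0n.
have -> : \sum_(p < n) \sum_(q < n)
      ((p < q) && (w (widen_ord (leqnSn n) q) < v (lift ord0 p))) =
    \sum_(p < n) \sum_(q < n)
      ((bump 0 p < bump 0 q) && (v (lift ord0 q) < v (lift ord0 p))) :> nat.
  by apply: eq_bigr => p _; apply: eq_bigr => q _; rewrite wv /bump !leq0n !add1n ltnS.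
set A := \sum_(p < n) \sum_(q < n) _; set B := \sum_(p < n) _; set C := \sum_(p < n) _.
move=> eBC; have {eBC} eBC : B = C + n by lia.
have Bn : B <= n.
  by rewrite -[leqRHS]card_ord -sum1_card; apply: leq_sum => p _; apply: leq_b1.
have /eqP : C = 0 by lia.
rewrite sum_nat_eq0 => /forallP C0.
apply: val_inj => /=; apply/eqP; rewrite -leqn0 leqNgt; apply/negP => v0.
pose q := v^-1%g ord0; have vq : v q = ord0 by rewrite permKV.
have [k|] := unliftP ord0 q; last by move=> q0; rewrite -q0 vq in v0.
by move=> qk; have := C0 k; rewrite /= -qk vq v0.
Qed.

(** * Next smaller positions and the vertices of the cube *)

Section NextSmaller.
Context {n : nat} (w : 'S_n.+1).
Implicit Types (p q : 'I_n.+1) (S T : {set 'I_n.+1}).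

(** The default [ord_max] is the value at [ord_max] itself, which makes the
    exchange at the last position trivial. *)
Definition next_smaller p : 'I_n.+1 :=
  [arg min_(q < ord_max | (p < q) && (w q < w p)) q : nat].

(** The left end of the largest interval ending at p on which w >= w p. *)
Definition block_start p : nat := \max_(q < n.+1 | (q < p) && (w q < w p)) q.+1.

Lemma block_start_le p : block_start p <= p.
Proof. by apply/bigmax_leqP => q /andP[]. Qed.

Lemma block_startP p q : block_start p <= q <= p -> w p <= w q.
Proof.
case/andP=> sq; rewrite leq_eqVlt => /orP[/eqP/val_inj->//|qp].
rewrite leqNgt; apply: contraL sq => wqp; rewrite -ltnNge.
by apply: (leq_bigmax_cond (F := fun q : 'I_n.+1 => q.+1)); rewrite qp.
Qed.

Lemma block_start_pred p : block_start p = 0 \/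
  exists q, [/\ block_start p = q.+1, q < p & w q < w p].
Proof.
have [/eqP e0|] := posnP #|[pred q : 'I_n.+1 | (q < p) && (w q < w p)]|.
  by left; rewrite /block_start big_pred0 // => q; exact: (card0_eq (eqP e0) q).
move=> /(eq_bigmax_cond (fun q : 'I_n.+1 => q.+1))[q].
by rewrite inE => /andP[qp wqp] e; right; exists q.
Qed.

Hypothesis wmax : w ord_max = ord0.

Lemma last_value p : (w p == 0 :> nat) = (p == ord_max).
Proof.
by apply/eqP/eqP => [p0|->]; [apply: (@perm_inj _ w); apply: val_inj|]; rewrite wmax.
Qed.

Lemma next_smallerP p : p != ord_max ->
  [/\ p < next_smaller p, w (next_smaller p) < w p &
      forall q, p < q < next_smaller p -> w p < w q].
Proof.
move=> p_max; rewrite /next_smaller; case: arg_minnP => [|q /andP[pq wqp] qmin].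
  by rewrite wmax lt0n last_value p_max andbT ltn_neqAle -ltnS ltn_ord andbT.
split=> // r /andP[pr rq]; rewrite ltnNge leq_eqVlt; apply/norP; split.
  by apply: perm_val_neq; rewrite -val_eqE eq_sym ltn_eqF.
by apply: contraL rq => wr; rewrite -leqNgt qmin ?pr.
Qed.

Lemma next_smaller_unique p q : p < q -> w q < w p ->
  (forall r : 'I_n.+1, p < r -> r < q -> w p < w r) -> q = next_smaller p.
Proof.
move=> pq wqp between.
have pn : p != ord_max by rewrite -last_value -lt0n (leq_ltn_trans _ wqp).
have [pj wj jmin] := next_smallerP pn; apply: val_inj.
case: (ltngtP q (next_smaller p)) => // [qj|jq].
  by have := jmin q; rewrite pq qj => /(_ isT); rewrite ltnNge ltnW.
by have := between _ pj jq; rewrite ltnNge ltnW.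
Qed.

Lemma next_smaller_max : next_smaller ord_max = ord_max.
Proof.
rewrite /next_smaller /arg_min /extremum; case: pickP => //= q /andP[/andP[]].
by rewrite ltnNge -ltnS ltn_ord.
Qed.

Definition swap p := tperm p (next_smaller p).

(** The values below t have been processed, in increasing order. This order
    guarantees that position p still carries w p when its turn comes, while its
    next smaller position carries some smaller value. *)
Fixpoint stage (S : {set 'I_n.+1}) (t : nat) : 'S_n.+1 :=
  if t is t'.+1 then
    let p := (w^-1)%g (inord t') in
    if p \in S then pmul (stage S t') (swap p) else stage S t'
  else w.

Definition vertex S := stage S n.+1.

Lemma stageS S t : t < n.+1 -> exists2 p, w p = t :> nat &
  stage S t.+1 = if p \in S then pmul (stage S t) (swap p) else stage S t.
Proof. by move=> tn; exists ((w^-1)%g (inord t)); rewrite //= permKV inordK. Qed.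

Lemma stageS_at S p :
  stage S (w p).+1 = if p \in S then pmul (stage S (w p)) (swap p) else stage S (w p).
Proof. by rewrite /= inord_val permK. Qed.

Lemma next_smaller_neq p q : w p < w q -> next_smaller p != q.
Proof.
move=> wpq; have [->|pn] := eqVneq p ord_max.
  by rewrite next_smaller_max; apply: contraTneq wpq => <-; rewrite wmax.
by have [_ wj _] := next_smallerP pn; apply: contraTneq wpq => <-; rewrite -leqNgt ltnW.
Qed.

Lemma stage_above S t p : t <= w p -> stage S t p = w p.
Proof.
elim: t => [//|t IHt] tp; have [q wq ->] := stageS S (leq_trans tp (ltnW (ltn_ord _))).
have {}IHt := IHt (ltnW tp); case: ifP => // _.
rewrite pmulE tpermD //; last by apply: next_smaller_neq; rewrite wq.
by apply: contraTneq tp => <-; rewrite wq ltnn.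
Qed.

Lemma stage_below S t p : w p < t -> stage S t p < t.
Proof.
rewrite !ltnNge; apply: contra => tx.
have := @stage_above S t ((w^-1)%g (stage S t p)); rewrite permKV => /(_ tx).
by move=> /perm_inj e; rewrite -e permKV.
Qed.

Lemma stage_eq_in S T t : (forall p, w p < t -> (p \in S) = (p \in T)) ->
  stage S t = stage T t.
Proof.
elim: t => [//|t IHt] ST.
have /IHt e : forall p, w p < t -> (p \in S) = (p \in T).
  by move=> p pt; apply: ST; apply: leqW.
rewrite /= e ST // permKV ltnS; case: (ltnP t n.+1) => tn; first by rewrite inordK.
exact: leq_trans (ltnW (ltn_ord _)) tn.
Qed.

Lemma vertex0 : vertex finset.set0 = w.
Proof.
suff stage0 t : stage finset.set0 t = w by apply: stage0.
by elim: t => //= t ->; rewrite inE.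
Qed.

Lemma vertex1 p : vertex [set p]%SET = pmul w (swap p).
Proof.
have low t : t <= w p -> stage [set p]%SET t = w.
  elim: t => [//|t IHt] tp.
  have [q wq ->] := stageS [set p]%SET (leq_trans tp (ltnW (ltn_ord _))).
  by rewrite inE (IHt (ltnW tp)); case: eqP wq => // -> e; rewrite e ltnn in tp.
have high t : w p < t -> t <= n.+1 -> stage [set p]%SET t = pmul w (swap p).
  elim: t => [//|t IHt]; rewrite ltnS leq_eqVlt => /orP[/eqP <- _|pt tn].
    by rewrite stageS_at inE eqxx low.
  have [q wq ->] := stageS [set p]%SET tn; rewrite inE (IHt pt (ltnW tn)).
  by case: eqP wq => // -> e; rewrite e ltnn in pt.
by apply: high.
Qed.

End NextSmaller.

Section Interval.
Context {n : nat} (v w : 'S_n.+1).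
Implicit Types (p q : 'I_n.+1) (S T : {set 'I_n.+1}).
Hypothesis vmin : v ord0 = ord0.
Hypothesis wmax : w ord_max = ord0.
Hypothesis wv : forall p : 'I_n, w (widen_ord (leqnSn n) p) = v (lift ord0 p).

Let pos_neq_max p t : w p = t.+1 :> nat -> p != ord_max.
Proof. by move=> wp; rewrite -(last_value wmax) wp. Qed.

(** The only small value that moves goes from [next_smaller w p] to p, and the
    positions that it passes carry values of w that are at least w p. *)
Lemma swap_mono p a b : p != ord_max -> w a < w p -> w b < w p -> a < b ->
  swap w p a < swap w p b.
Proof.
move=> pn wa wb ab; have [pj wj between] := next_smallerP wmax pn.
have ap : a != p by apply: contraTneq wa => ->; rewrite ltnn.
have bp : b != p by apply: contraTneq wb => ->; rewrite ltnn.
rewrite /swap; case: (tpermP _ _ a) ap ab => [->|->|/eqP _ /eqP aj _ ab].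
- by rewrite eqxx.
- move=> _ jb; rewrite tpermD //; first exact: ltn_trans pj jb.
    by rewrite eq_sym.
  by apply: contraTneq jb => ->; rewrite ltnn.
case: (tpermP _ _ b) bp ab => [->|->|_ _ _ //]; first by rewrite eqxx.
move=> _ aj'; rewrite ltnNge leq_eqVlt eq_sym (negPf (_ : (a : nat) != p)) /=.
  apply/negP => pa; have := between a; rewrite pa aj' => /(_ isT).
  by rewrite ltnNge ltnW.
by apply: contraTneq wa => /val_inj->; rewrite ltnn.
Qed.

(** Adding p to S inserts one more exchange. Conjugating it by the later ones
    gives a transposition of positions that still stand in the same order, by
    [swap_mono], so its effect is to remove an inversion. *)
Lemma vertex_flip S p : p != ord_max -> p \notin S ->
  bruhat_step (vertex w (p |: S)%SET) (vertex w S).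
Proof.
move=> pn pS.
have [pj wj _] := next_smallerP wmax pn.
have low : stage w (p |: S)%SET (w p) = stage w S (w p).
  by apply: stage_eq_in => q qp; rewrite !inE; case: eqP qp => // ->; rewrite ltnn.
have high t : w p < t -> t <= n.+1 -> exists a b : 'I_n.+1,
    [/\ a < b, w a < t, w b < t, stage w S t b < stage w S t a &
        stage w (p |: S)%SET t = pmul (stage w S t) (tperm a b)].
  elim: t => [//|t IHt]; rewrite ltnS leq_eqVlt => /orP[/eqP <- _|pt tn].
    exists p, (next_smaller w p); rewrite !stageS_at !inE eqxx (negPf pS) low.
    split=> //; first exact: leqW.
    by rewrite (stage_above wmax _ (leqnn _)) stage_below.
  have [a [b [ab wa wb sab e]]] := IHt pt (ltnW tn).
  have [q wq eq_] := stageS w S tn; have [q' wq' ->] := stageS w (p |: S)%SET tn.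
  have {q' wq'} -> : q' = q by apply: (@perm_inj _ w); apply: val_inj; rewrite /= wq wq'.
  rewrite eq_ finset.in_setU1 e; have -> /= : (q == p) = false.
    by apply: contraTF pt => /eqP <-; rewrite wq ltnn.
  have qn : q != ord_max by rewrite -(last_value wmax) wq -lt0n (leq_ltn_trans _ pt).
  case: ifP => qS; last by exists a, b; split=> //; apply: leqW.
  have [qj wjq _] := next_smallerP wmax qn.
  have swap_below c : w c < t -> w (swap w q c) < t.+1.
    rewrite /swap; case: tpermP => [->|->|_ _ /leqW //]; last by rewrite wq.
    by rewrite wq ltnn.
  exists (swap w q a), (swap w q b); rewrite !pmulE !tpermK; split=> //.
  - by apply: swap_mono; rewrite ?wq.
  - exact: swap_below.
  - exact: swap_below.
  rewrite /pmul -tpermJ conjgE /swap tpermV !mulgA.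
  by rewrite -(mulgA _ (tperm q _) (tperm q _)) tperm2 mulg1.
rewrite /vertex; have [a [b [ab _ _ sab ->]]] := high n.+1 (ltn_ord _) (leqnn _).
exact: bruhat_step_tperm.
Qed.

Lemma vertex_antitone S T : S \subset T -> (forall p, p \in T -> p != ord_max) ->
  bruhat (vertex w T) (vertex w S).
Proof.
move: {2}#|T :\: S| (leqnn #|T :\: S|) => k; elim: k S => [|k IHk] S Sk ST Tn.
  suff -> : S = T by apply: connect0.
  apply/eqP; rewrite finset.eqEsubset ST /= -finset.setD_eq0 -cards_eq0 -leqn0 //.
have [/eqP|[p]] := set_0Vmem (T :\: S).
  rewrite finset.setD_eq0 => TS; suff -> : S = T by apply: connect0.
  by apply/eqP; rewrite finset.eqEsubset ST.
move=> pTS; have := pTS; rewrite finset.in_setD => /andP[pS pT].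
apply: connect_trans (connect1 (vertex_flip (Tn p pT) pS)).
apply: IHk Tn; last by rewrite finset.subUset finset.sub1set pT.
by move: Sk; rewrite (cardsD1 p) pTS finset.setDDl finset.setUC.
Qed.

Definition full : {set 'I_n.+1} := [set p | p != ord_max]%SET.

(** When all exchanges are made, the values below t have been shifted one place
    to the right among the positions that carry them in w. *)
Lemma stage_full t : 0 < t -> t <= n.+1 -> forall p, w p < t ->
  (forall q, q < p -> w q < t -> (forall r : 'I_n.+1, q < r < p -> t <= w r) ->
     stage w full t p = w q) /\
  ((forall r : 'I_n.+1, r < p -> t <= w r) -> stage w full t p = ord0).
Proof.
elim: t => [//|[_ _ _ p|t IHt _ tn p]].
  rewrite ltnS leqn0 last_value // => /eqP ->.
  have [q0 wq0 ->] := stageS w full (ltn0Sn n).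
  have /eqP -> : q0 == ord_max by rewrite -(last_value wmax) wq0.
  rewrite inE eqxx /=; split=> [q|_]; last by rewrite wmax.
  by move=> qn; rewrite ltnS leqn0 last_value // => /eqP qe; rewrite qe ltnn in qn.
have {}IHt := IHt isT (ltnW tn); rewrite ltnS => wpt.
have [q wq ->] := stageS w full tn.
have qn := pos_neq_max wq; rewrite inE qn.
have [qj wj between] := next_smallerP wmax qn.
have lt_wq r : r != q -> w r <= t.+1 -> w r < t.+1.
  by move=> rq; rewrite leq_eqVlt -wq (negPf (perm_val_neq w rq)).
(* Position q now holds what its next smaller position held. *)
have [->|pq] := eqVneq p q.
  rewrite pmulE /swap tpermL.
  have [IH1 IH2] := IHt (next_smaller w q) (leq_trans wj (eq_leq wq)).
  have fill (r : 'I_n.+1) : q <= r < next_smaller w q -> t.+1 <= w r.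
    case/andP; rewrite leq_eqVlt => /orP[/eqP/val_inj<- _|qr rj]; first by rewrite wq.
    by rewrite -wq ltnW // between // qr.
  split=> [r rq wr rest|rest].
    apply: IH1 => [||k /andP[rk kj]]; first exact: ltn_trans rq qj.
      by apply: lt_wq => //; apply: contraTneq rq => ->; rewrite ltnn.
    by case: (ltnP k q) => kq; [rewrite ltnW // rest // rk|apply: fill; rewrite kq].
  apply: IH2 => k kj; case: (ltnP k q) => kq; first by rewrite ltnW // rest.
  by apply: fill; rewrite kq.
(* The next smaller position of q has received the value of q. *)
have [->|pj] := eqVneq p (next_smaller w q).
  rewrite pmulE /swap tpermR stage_above ?wq //; split=> [r rj wr rest|rest]; last first.
    by have := rest _ qj; rewrite wq ltnn.
  case: (ltngtP r q) => [rq|qr|/val_inj-> //].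
    by have := rest q; rewrite rq qj wq ltnn => /(_ isT).
  have := between r; rewrite qr rj => /(_ isT); rewrite wq => h.
  by have := leq_trans h wr; rewrite ltnn.
rewrite pmulE /swap tpermD 1?eq_sym //.
have wp := lt_wq _ pq wpt; have [IH1 IH2] := IHt p wp.
split=> [r rp wr rest|rest]; last by apply: IH2 => k /rest/ltnW.
have [rq|rq] := eqVneq r q.
  rewrite {r}rq in rp wr rest *.
  case: (ltngtP p (next_smaller w q)) => [pj'|jp|/val_inj e].
  - have := between p; rewrite rp pj' => /(_ isT); by rewrite wq ltnNge ltnW.
  - have := rest (next_smaller w q); rewrite qj jp => /(_ isT) tj.
    by have := leq_trans wj (eq_leq wq); rewrite ltnNge ltnW.
  - by rewrite e eqxx in pj.
by apply: IH1 => [||k /rest/ltnW //] //; apply: lt_wq.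
Qed.

Lemma w_pred p q : p = q.+1 :> nat -> w q = v p.
Proof.
move=> pq; have qn : q < n by rewrite -ltnS -pq.
rewrite (_ : q = widen_ord (leqnSn n) (Ordinal qn)); last exact: val_inj.
by rewrite wv; congr (v _); apply: val_inj; rewrite /= /bump.
Qed.

Lemma vertex_full : vertex w full = v.
Proof.
apply/permP => p; have [IH1 IH2] := stage_full (ltn0Sn n) (leqnn _) (ltn_ord (w p)).
case: (posnP p) => [p0|p0].
  have -> : p = ord0 by apply: val_inj.
  by rewrite vmin; rewrite (_ : p = ord0) in IH2; [apply: IH2|apply: val_inj].
have qn : p.-1 < n.+1 by apply: leq_ltn_trans (leq_pred _) (ltn_ord p).
rewrite -(@w_pred p (Ordinal qn)) /= ?prednK //.
apply: IH1 => //=; first by rewrite prednK.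
by move=> r /andP[]; rewrite prednK // leqNgt => /negPf->.
Qed.

Lemma vertex_interval S : S \subset full ->
  (bruhat v (vertex w S)) && (bruhat (vertex w S) w).
Proof.
move=> Sfull; apply/andP; split.
  by rewrite -{1}vertex_full; apply: vertex_antitone => // p; rewrite inE.
rewrite -[X in bruhat _ X](vertex0 w); apply: vertex_antitone.
  exact: finset.sub0set.
by move=> p /(fintype.subsetP Sfull); rewrite inE.
Qed.

End Interval.

(** * Facets of the polytope *)

Section Blocks.
Context {n : nat} (v w : 'S_n.+1).
Implicit Types (p q : 'I_n.+1) (S T : {set 'I_n.+1}).
Hypothesis vmin : v ord0 = ord0.
Hypothesis wmax : w ord_max = ord0.
Hypothesis wv : forall p : 'I_n, w (widen_ord (leqnSn n) p) = v (lift ord0 p).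

Lemma block_sum_swap (z : 'S_n.+1) q a b :
  (a <= q < b) = (a <= next_smaller w q < b) ->
  block_sum (pmul z (swap w q)) a b = block_sum z a b.
Proof.
move=> ab; rewrite /block_sum [RHS](reindex_inj (@perm_inj _ (swap w q))).
apply: eq_big => [p|p _]; last by rewrite pmulE.
by rewrite /swap; case: tpermP => [->|->|] //.
Qed.

Lemma block_sum_stage S a b t0 t : t0 <= t -> t <= n.+1 ->
  (forall q, t0 <= w q -> (a <= q < b) = (a <= next_smaller w q < b)) ->
  block_sum (stage w S t) a b = block_sum (stage w S t0) a b.
Proof.
move=> t0t tn stable; elim: t t0t tn => [|t IHt]; first by rewrite leqn0 => /eqP ->.
rewrite leq_eqVlt => /orP[/eqP -> //|]; rewrite ltnS => t0t tn.
have [q wq ->] := stageS w S tn; rewrite -(IHt t0t (ltnW tn)).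
by case: ifP => // _; apply: block_sum_swap; apply: stable; rewrite wq.
Qed.

(** An exchange at a value larger than w p does not cross the ends of the block
    of p, since both p and the position just before the block carry values of
    at most w p. *)
Lemma block_start_stable p q : p != ord_max -> w p < w q ->
  (block_start w p <= q < p.+1) = (block_start w p <= next_smaller w q < p.+1).
Proof.
move=> pn wpq; have qn : q != ord_max.
  by rewrite -(last_value wmax) -lt0n (leq_ltn_trans _ wpq).
have [qj wj between] := next_smallerP wmax qn; rewrite !ltnS.
apply/andP/andP => -[le1 le2]; split.
- exact: leq_trans le1 (ltnW qj).
- rewrite leqNgt; apply/negP => pj; have := between p; rewrite pj andbT.
  rewrite ltn_neqAle le2 andbT; case: eqP => [/val_inj e|_ /(_ isT)].
    by rewrite e ltnn in wpq.
  by rewrite ltnNge ltnW.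
- have [-> //|[r [e rp wr]]] := block_start_pred w p; rewrite e in le1 *.
  rewrite ltnNge leq_eqVlt; apply/norP; split.
    by apply: contraTneq (ltn_trans wr wpq) => /val_inj->; rewrite ltnn.
  apply/negP => qr; have := between r; rewrite qr le1 ltnNge => /(_ isT).
  by rewrite ltnW // (ltn_trans wr).
- exact: leq_trans (ltnW qj) le2.
Qed.

Lemma shifted_block_stable p q : p != ord_max -> w p < w q ->
  (p.+1 <= q < (next_smaller w p).+1) =
  (p.+1 <= next_smaller w q < (next_smaller w p).+1).
Proof.
move=> pn wpq; have qn : q != ord_max.
  by rewrite -(last_value wmax) -lt0n (leq_ltn_trans _ wpq).
have [qj wj between] := next_smallerP wmax qn.
have [pj wj' between'] := next_smallerP wmax pn.
rewrite !ltnS; apply/andP/andP => -[le1 le2]; split.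
- exact: leq_trans le1 (ltnW qj).
- rewrite leqNgt; apply/negP => jj; have := between (next_smaller w p).
  rewrite jj andbT ltn_neqAle le2 andbT; case: eqP => [/val_inj e|_ /(_ isT)].
    by move: wpq; rewrite e ltnNge ltnW.
  by rewrite ltnNge ltnW // (ltn_trans wj').
- rewrite ltnNge leq_eqVlt; apply/norP; split.
    by apply: contraTneq wpq => /val_inj->; rewrite ltnn.
  by apply/negP => qp; have := between p; rewrite qp le1 ltnNge ltnW // => /(_ isT).
- exact: leq_trans (ltnW qj) le2.
Qed.

Lemma block_sum_recr (z : 'S_n.+1) a p : a <= p ->
  block_sum z a p.+1 = block_sum z a p + z p.
Proof.
move=> ap; rewrite /block_sum (bigD1 p) /= ?ap ?ltnSn // addnC; congr (_ + _).
apply: eq_bigl => q; rewrite ltnS [in RHS]ltn_neqAle.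
by case: (a <= q) => //=; rewrite andbC.
Qed.

(** The last exchange that can change the sum is the one at p, which replaces
    w p by a smaller value. *)
Lemma vertex_block_sum S p : p != ord_max ->
  (block_sum (vertex w S) (block_start w p) p.+1 ==
     block_sum w (block_start w p) p.+1) = (p \notin S).
Proof.
move=> pn; have [pj wj _] := next_smallerP wmax pn.
rewrite (block_sum_stage S (t0 := (w p).+1) (t := n.+1)) ?ltn_ord //; last first.
  by move=> q; apply: block_start_stable.
rewrite !block_sum_recr ?block_start_le // stageS_at.
rewrite (_ : block_sum _ _ p = block_sum w (block_start w p) p).
  rewrite eqn_add2l; case: ifP => pS; last by rewrite stage_above ?eqxx.
  rewrite pmulE /swap tpermL; apply/negbTE; rewrite neq_ltn.
  by rewrite (stage_below wmax S wj).
apply: eq_bigr => q /andP[sq qp]; have wpq : w p <= w q.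
  by apply: (@block_startP _ w p q); rewrite sq ltnW.
case: ifP => _; last by rewrite stage_above.
rewrite pmulE /swap tpermD ?stage_above //; first by rewrite -val_eqE neq_ltn qp orbT.
by rewrite -val_eqE neq_ltn (ltn_trans qp pj) orbT.
Qed.

(** The exchange at p, if made, brings w p into the block, and otherwise a
    smaller value remains in its place; v is the case where all exchanges are
    made. *)
Lemma vertex_shifted_block_sum S p : p != ord_max ->
  (block_sum (vertex w S) p.+1 (next_smaller w p).+1 ==
     block_sum v p.+1 (next_smaller w p).+1) = (p \in S).
Proof.
move=> pn; have [pj wj between] := next_smallerP wmax pn.
have E T : block_sum (vertex w T) p.+1 (next_smaller w p).+1 =
    block_sum w p.+1 (next_smaller w p) +
    (if p \in T then w p : nat else stage w T (w p) (next_smaller w p)).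
  rewrite (block_sum_stage T (t0 := (w p).+1) (t := n.+1)) ?ltn_ord //; last first.
    by move=> q; apply: shifted_block_stable.
  rewrite block_sum_recr // stageS_at; congr (_ + _); last first.
    by case: ifP => // _; rewrite pmulE /swap tpermR stage_above.
  apply: eq_bigr => q /andP[pq qj]; have wpq : w p <= w q by rewrite ltnW // between ?pq.
  case: ifP => _; last by rewrite stage_above.
  rewrite pmulE /swap tpermD ?stage_above //; first by rewrite -val_eqE neq_ltn pq.
  by rewrite -val_eqE neq_ltn qj orbT.
rewrite -[in X in _ == X](vertex_full vmin wmax wv) !E inE pn eqn_add2l.
by case: ifP => _; rewrite ?eqxx // ltn_eqF // stage_below.
Qed.

End Blocks.

Section Facets.
Context {n : nat} (v w : 'S_n.+1).
Implicit Types (p q : 'I_n.+1) (S T : {set 'I_n.+1}).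
Hypothesis vmin : v ord0 = ord0.
Hypothesis wmax : w ord_max = ord0.
Hypothesis wv : forall p : 'I_n, w (widen_ord (leqnSn n) p) = v (lift ord0 p).

(** The extra letter 0 at the front of v is not counted by thresholds t.+1. *)
Lemma rank_count_shift k t : rank_count v k.+1 t.+1 = rank_count w k t.+1.
Proof.
rewrite /rank_count big_ord_recl [in RHS]big_ord_recr /= vmin wmax andbF add0n addn0.
by apply: eq_bigr => p _; rewrite wv /bump.
Qed.

(** The position just before the block of p and the last position of its shifted
    block carry values below w p; after such a position, v and w have the same
    counts of larger values. *)
Lemma rank_count_eq_after q t : w q <= t ->
  rank_count v q.+1 t.+1 = rank_count w q.+1 t.+1.
Proof. by move=> wq; rewrite rank_count_shift rank_countS ltnNge wq addn0. Qed.

(** A sum over a block is a sum over thresholds of differences of two rank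
    counts; those of z at b and a are bounded by those of w and v. Below m, the
    block of u already has the largest possible counts. *)
Lemma block_sum_le (z u : 'S_n.+1) a b m : a <= b ->
  bruhat v z -> bruhat z w -> (forall q, a <= q < b -> m <= u q) ->
  (forall t, m <= t -> rank_count w b t.+1 + rank_count u a t.+1 <=
     rank_count u b t.+1 + rank_count v a t.+1) ->
  block_sum z a b <= block_sum u a b.
Proof.
move=> ab vz zw um rk; rewrite !block_sum_count; apply: leq_sum => t _.
have [tm|mt] := ltnP t m.
  by apply: leq_sum => q /um mq; rewrite (leq_trans tm mq) leq_b1.
have := rk _ mt; rewrite !(rank_count_cat _ _ ab).
have := bruhat_rank_count b t.+1 zw; have := bruhat_rank_count a t.+1 vz.
rewrite !(rank_count_cat _ _ ab); lia.
Qed.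

Lemma block_sum_valid (z : 'S_n.+1) p : bruhat v z -> bruhat z w ->
  block_sum z (block_start w p) p.+1 <= block_sum w (block_start w p) p.+1.
Proof.
move=> vz zw; apply: (@block_sum_le z w _ _ (w p)) => //.
- by rewrite leqW // block_start_le.
- by move=> q; rewrite ltnS; apply: block_startP.
move=> t wpt; rewrite leq_add2l.
have [->|[q [-> _ wq]]] := block_start_pred w p; first by rewrite !rank_count0.
by rewrite rank_count_eq_after // (leq_trans (ltnW wq)).
Qed.

Lemma shifted_block_sum_valid (z : 'S_n.+1) p :
  p != ord_max -> bruhat v z -> bruhat z w ->
  block_sum z p.+1 (next_smaller w p).+1 <=
    block_sum v p.+1 (next_smaller w p).+1.
Proof.
move=> pn vz zw; have [pj wj between] := next_smallerP wmax pn.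
apply: (@block_sum_le z v _ _ (w p)) => //; first by rewrite ltnS ltnW.
- move=> q /andP[pq qj].
  have [r qr] : exists r : 'I_n.+1, q = r.+1 :> nat.
    have q1 : q.-1 < n.+1 by apply: leq_ltn_trans (leq_pred _) (ltn_ord q).
    by exists (Ordinal q1); rewrite /= prednK // (leq_trans _ pq).
  rewrite -(w_pred wv qr); move: pq qj.
  rewrite qr !ltnS leq_eqVlt => /orP[/eqP/val_inj-> //|pr rj].
  by rewrite ltnW // between ?pr.
by move=> t wpt; rewrite leq_add2r rank_count_eq_after // (leq_trans (ltnW wj)).
Qed.

(** * Coatoms *)

Lemma next_smaller_coatom (i j : 'I_n.+1) : i < j -> w j < w i ->
  (forall p, i < p -> p < j -> w i < w p) -> pmul w (tperm i j) \in coatoms v w.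
Proof.
move=> ij wji between; have jE := next_smaller_unique wmax ij wji between.
have i_n : i != ord_max by rewrite -(last_value wmax) -lt0n (leq_ltn_trans _ wji).
have intv : bruhat v (pmul w (tperm i j)) && bruhat (pmul w (tperm i j)) w.
  rewrite jE -/(swap w i) -(vertex1 w i); apply: vertex_interval => //.
  by rewrite finset.sub1set inE.
have lt_w : inversions w = (inversions (pmul w (tperm i j))).+1.
  rewrite (inversions_tperm ij wji) big1 ?addn1 // => p /andP[/andP[ip pj] /andP[_]].
  by rewrite ltnNge ltnW // between.
rewrite !inE intv /=; apply/andP; split.
  rewrite /bruhat_lt /= (andP intv).2 andbT; apply/eqP => e.
  by move: lt_w; rewrite e; lia.
apply/existsP => -[x /andP[/bruhat_lt_inversions l1 /bruhat_lt_inversions l2]].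
by move: l2; rewrite lt_w ltnS leqNgt l1.
Qed.

Lemma interval_tperm_between (i j : 'I_n.+1) : i < j ->
  bruhat v (pmul w (tperm i j)) -> bruhat (pmul w (tperm i j)) w ->
  w j < w i /\ (forall p, i < p -> p < j -> w i < w p).
Proof.
move=> ij vz zw; have wji : w j < w i.
  have [//|wij] := ltnP (w j) (w i).
  have := bruhat_inversions zw; rewrite leqNgt -[X in X < _](congr1 _ (pmul_tpermK w i j)).
  rewrite inversions_tperm_lt // !pmulE tpermL tpermR ltn_neqAle wij andbT perm_val_neq //.
  by rewrite -val_eqE ltn_eqF.
(* Count the values that are at least w i among the first p.+1 positions. The
   exchange removes w i from them, while v has as many there as w. *)
split=> // p ip pj; rewrite ltnNge leq_eqVlt (negPf (perm_val_neq w _)) /=; last first.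
  by rewrite -val_eqE gtn_eqF.
apply/negP => wpi; have := bruhat_rank_count p.+1 (w i) vz.
rewrite -[X in rank_count _ _ X](prednK (leq_ltn_trans (leq0n _) wpi)) => vle.
have {vle} : rank_count w p.+1 (w i) <= rank_count (pmul w (tperm i j)) p.+1 (w i).
  move: vle; rewrite rank_count_eq_after ?prednK ?(leq_ltn_trans _ wpi) //.
  by rewrite -ltnS prednK // (leq_ltn_trans _ wpi).
have ne : i != j by apply: contraTneq ij => ->; rewrite ltnn.
rewrite /rank_count (bigD1 i) // (bigD1 j) 1?eq_sym //=.
rewrite [leqRHS](bigD1 i) // (bigD1 j) 1?eq_sym //=.
rewrite !pmulE tpermL tpermR leqnn andbT !ltnS (ltnW ip) (leqNgt j p) pj /= !add0n.
rewrite (leqNgt (w i) (w j)) wji /= add0n.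
rewrite [leqRHS](eq_bigr (fun q : 'I_n.+1 => ((q < p.+1) && (w i <= w q)) : nat)).
  by rewrite add1n ltnn.
by move=> q /andP[qi qj]; rewrite pmulE tpermD // eq_sym.
Qed.

(** A coatom is the source of the last step of a chain ending at w. *)
Lemma coatoms_image : coatoms v w =
  [set pmul w (swap w (widen_ord (leqnSn n) i)) | i : 'I_n]%SET.
Proof.
apply/setP => z; apply/idP/imsetP => [|[i _ ->]]; last first.
  have i_n : widen_ord (leqnSn n) i != ord_max by rewrite -val_eqE /= ltn_eqF.
  have [ij wj between] := next_smallerP wmax i_n.
  by apply: next_smaller_coatom => // p ip pj; apply: between; rewrite ip.
rewrite !inE => /andP[/andP[vz zw] /andP[/andP[z_w _] /existsP cov]].
have [y zy yw] := bruhat_lastP zw z_w.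
have ez : z = y.
  apply/eqP/negP => /negP z_y; apply: cov; exists y; rewrite /bruhat_lt /= z_y zy /=.
  apply/andP; split; last exact: connect1.
  apply: contraTneq yw => ->.
  by apply/negP => /andP[_]; rewrite ltnn.
have [i [j [ij wji zE]]] := bruhat_stepP yw; rewrite -{y zy yw}ez in zE.
rewrite zE in vz zw *; have [_ between] := interval_tperm_between ij vz zw.
have i_n : i < n by rewrite -ltnS (leq_trans _ (ltn_ord j)).
exists (Ordinal i_n) => //.
have -> : widen_ord (leqnSn n) (Ordinal i_n) = i by apply: val_inj.
by rewrite /swap -(next_smaller_unique wmax ij wji between).
Qed.

Lemma card_coatoms : #|coatoms v w| = n.
Proof.
rewrite coatoms_image card_imset ?card_ord // => i i' e.
have {}e := mulIg _ _ _ e.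
have lt_next k : widen_ord (leqnSn n) k < next_smaller w (widen_ord (leqnSn n) k).
  by have [|//] := next_smallerP wmax (_ : widen_ord (leqnSn n) k != ord_max);
  rewrite -val_eqE /= ltn_eqF.
have [le|lt|/val_inj//] := ltngtP i i'.
  have := congr1 (fun s : 'S_n.+1 => val (s (widen_ord (leqnSn n) i))) e.
  rewrite /= tpermL tpermD; first by move=> h; have := lt_next i; rewrite h ltnn.
    by rewrite -val_eqE /= gtn_eqF.
  by rewrite -val_eqE /= gtn_eqF // (ltn_trans le) // lt_next.
have := congr1 (fun s : 'S_n.+1 => val (s (widen_ord (leqnSn n) i'))) e.
rewrite /= tpermL tpermD; first by move=> h; have := lt_next i'; rewrite -h ltnn.
  by rewrite -val_eqE /= gtn_eqF.
by rewrite -val_eqE /= gtn_eqF // (ltn_trans lt) // lt_next.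
Qed.

End Facets.

(** * Polytopes with the facets and vertices of a cube *)

Local Open Scope classical_set_scope.
Local Open Scope ring_scope.

Section Dot.
Context {R : realType} {d : nat}.
Implicit Types c x y : 'rV[R]_d.

Definition dot c x : R := \sum_i c 0 i * x 0 i.

Lemma dotDr c x y : dot c (x + y) = dot c x + dot c y.
Proof. by rewrite -big_split; apply: eq_bigr => i _; rewrite mxE mulrDr. Qed.

Lemma dotZr c a x : dot c (a *: x) = a * dot c x.
Proof. by rewrite mulr_sumr; apply: eq_bigr => i _; rewrite mxE mulrCA. Qed.

Lemma dotBr c x y : dot c (x - y) = dot c x - dot c y.
Proof. by rewrite dotDr -scaleN1r dotZr mulN1r. Qed.

Lemma dot0r c : dot c 0 = 0.
Proof. by rewrite -(scale0r (0 : 'rV_d)) dotZr mul0r. Qed.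

Lemma dot_sumr c (I : finType) (F : I -> 'rV[R]_d) :
  dot c (\sum_i F i) = \sum_i dot c (F i).
Proof. by apply: (big_morph (dot c)) => [x y|]; rewrite ?dotDr ?dot0r. Qed.

Lemma dot_suml (I : finType) (P : pred I) (F : I -> 'rV[R]_d) x :
  dot (\sum_(i | P i) F i) x = \sum_(i | P i) dot (F i) x.
Proof.
rewrite /dot exchange_big; apply: eq_bigr => k _.
by rewrite summxE mulr_suml.
Qed.

Lemma dot_delta i x : dot (delta_mx 0 i) x = x 0 i.
Proof.
rewrite /dot (bigD1 i) //= mxE !eqxx mul1r big1 ?addr0 // => k ki.
by rewrite mxE (negPf ki) andbF mul0r.
Qed.

Lemma dotNl c x : dot (- c) x = - dot c x.
Proof. by rewrite -sumrN; apply: eq_bigr => i _; rewrite mxE mulNr. Qed.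

Lemma faces_dot (P F : set 'rV[R]_d) : faces P F <->
  exists c t, (forall x, P x -> dot c x <= t) /\ F = P `&` [set x | dot c x = t].
Proof. by []. Qed.

End Dot.

(** The nonempty faces of a cube are given by fixing some coordinates at one of
    their two extreme values, so they are indexed by partial assignments. *)
Definition cubical_faces {R : realType} {d : nat} (n : nat)
    (P : set 'rV[R]_d) (face : ('I_n -> option bool) -> set 'rV[R]_d) :=
  [/\ forall F, faces P F -> F = set0 \/ exists sigma, F = face sigma,
      forall sigma, faces P (face sigma) /\ face sigma !=set0 &
      forall sigma tau, face sigma `<=` face tau <->
        forall i s, tau i = Some s -> sigma i = Some s].

Section CubicalPolytope.
Context {R : realType} {d n m : nat} (P : set 'rV[R]_d).
Context (V : {set 'I_n} -> 'rV[R]_d).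
Context (c : 'I_n -> bool -> 'rV[R]_d) (b : 'I_n -> bool -> R).
Context (U : 'M[R]_(m, d)).
Hypothesis PV : forall e, P (V e).
Hypothesis Pvalid : forall i s x, P x -> dot (c i s) x <= b i s.
Hypothesis Vtight : forall i s e, dot (c i s) (V e) = b i s <-> (i \in e) = s.
Hypothesis Pdir : forall x y, P x -> P y -> (x - y <= U)%MS.
Hypothesis rkU : (\rank U <= n)%N.

(* The facets (i, true) and (i, false) are opposite: every vertex lies on exactly
   one of them. *)

Let flip (e : {set 'I_n}) i : {set 'I_n} := [set k | (k \in e) (+) (k == i)]%SET.
Let edge (e : {set 'I_n}) i : 'rV[R]_d := V (flip e i) - V e.

Let in_flip (e : {set 'I_n}) i k : (k \in flip e i) = (k \in e) (+) (k == i).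
Proof. by rewrite inE. Qed.

Let edge_tight (e : {set 'I_n}) i k : dot (c k (k \in e)) (edge e i) = 0 <-> k != i.
Proof.
rewrite /edge dotBr ((Vtight k (k \in e) e).2 erefl).
have T := Vtight k (k \in e) (flip e i).
split=> [/eqP|ki]; last first.
  by apply/eqP; rewrite subr_eq0; apply/eqP/T; rewrite in_flip (negPf ki) addbF.
rewrite subr_eq0 => /eqP /T; rewrite in_flip.
by case: (k == i); case: (k \in e).
Qed.

Let edge_lt0 (e : {set 'I_n}) i : dot (c i (i \in e)) (edge e i) < 0.
Proof.
rewrite lt_neqAle; apply/andP; split.
  by apply/eqP => /edge_tight; rewrite eqxx.
by rewrite /edge dotBr ((Vtight i (i \in e) e).2 erefl) subr_le0 Pvalid.
Qed.

(** The facets through a vertex are dual to the edges at it up to positive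
    factors, so the edges are independent and, by the rank bound, span the
    directions of the polytope. The coordinates along them are the slacks of
    these facets, whence the signs. *)
Lemma edge_coordinates (e : {set 'I_n}) x : P x -> exists y : 'I_n -> R,
  [/\ x = V e + \sum_i y i *: edge e i,
      forall i, 0 <= y i &
      forall i, y i = 0 <-> dot (c i (i \in e)) x = b i (i \in e)].
Proof.
move=> Px; pose E : 'M[R]_(n, d) := \matrix_i edge e i.
have dotE (u : 'rV_n) k :
    dot (c k (k \in e)) (u *m E) = u 0 k * dot (c k (k \in e)) (edge e k).
  rewrite mulmx_sum_row dot_sumr (bigD1 k) //= big1 => [|i ik].
    by rewrite addr0 dotZr rowK.
  by rewrite dotZr rowK (edge_tight e i k).2 ?mulr0 // eq_sym.
have freeE : row_free E.
  apply: inj_row_free => u uE; apply/rowP => k; rewrite mxE.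
  have /eqP := dotE u k; rewrite uE dot0r eq_sym mulf_eq0.
  by rewrite (lt_eqF (edge_lt0 e k)) orbF => /eqP.
have EU : (E <= U)%MS by apply/row_subP => i; rewrite rowK; apply: Pdir.
have UE : (U <= E)%MS.
  rewrite -(mxrank_leqif_sup EU) eqn_leq mxrankS //=.
  by rewrite (eqP (freeE : \rank E == n)).
have /submxP[u xu] := submx_trans (Pdir Px (PV e)) UE.
have xe : x = V e + \sum_i u 0 i *: edge e i.
  rewrite -[LHS](subrK (V e)) xu addrC mulmx_sum_row; congr (_ + _).
  by apply: eq_bigr => i _; rewrite rowK.
have dx i : dot (c i (i \in e)) x - b i (i \in e) =
    u 0 i * dot (c i (i \in e)) (edge e i).
  by rewrite -dotE -xu dotBr ((Vtight i (i \in e) e).2 erefl).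
exists (fun i => u 0 i); split=> // i.
  have: dot (c i (i \in e)) x - b i (i \in e) <= 0 by rewrite subr_le0 Pvalid.
  by rewrite dx nmulr_lle0.
split=> [u0|/eqP]; first by apply/eqP; rewrite -subr_eq0 dx u0 mul0r.
by rewrite -subr_eq0 dx mulf_eq0 (lt_eqF (edge_lt0 e i)) orbF => /eqP.
Qed.

Definition cface (sigma : 'I_n -> option bool) : set 'rV[R]_d :=
  [set x | P x /\ forall i s, sigma i = Some s -> dot (c i s) x = b i s].

Lemma V_cface sigma (e : {set 'I_n}) :
  cface sigma (V e) <-> forall i s, sigma i = Some s -> (i \in e) = s.
Proof.
split=> [[_ h] i s /h /Vtight //|h]; split=> // i s /h; exact: (Vtight i s e).2.
Qed.

Lemma cface_neq0 sigma : cface sigma !=set0.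
Proof.
exists (V [set i | sigma i == Some true]%SET); apply/V_cface => i s.
by rewrite inE => ->; case: s.
Qed.

(** If tau fixes i to s and sigma does not, some vertex of sigma has the
    opposite value at i. *)
Lemma cface_sub sigma tau : cface sigma `<=` cface tau <->
  forall i s, tau i = Some s -> sigma i = Some s.
Proof.
split=> [st i s ti|h x [Px hx]]; last by split=> // i s /h /hx.
pose e := [set k | if sigma k is Some s' then s' else ~~ s]%SET.
have /st/V_cface/(_ i s ti) : cface sigma (V e).
  by apply/V_cface => k s' sk; rewrite inE sk.
by rewrite inE; case: (sigma i) => [s' ->|] //; case: s {ti e}.
Qed.

(** Add up the inequalities of the facets involved. *)
Lemma cface_face sigma : faces P (cface sigma).
Proof.
pose D i := sigma i != None; pose s i := odflt true (sigma i).
apply/faces_dot; exists (\sum_(i | D i) c i (s i)), (\sum_(i | D i) b i (s i)).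
split=> [x Px|].
  by rewrite dot_suml; apply: ler_sum => i _; apply: Pvalid.
apply/seteqP; split=> x [Px hx]; split=> //=.
  rewrite dot_suml; apply: eq_bigr => i Di; apply: hx.
  by move: Di; rewrite /D /s; case: (sigma i).
move=> i t it; have Di : D i by rewrite /D it.
have <- : s i = t by rewrite /s it.
apply/esym/eqP; rewrite -subr_eq0; apply/eqP.
pose G k := b k (s k) - dot (c k (s k)) x.
apply: (@psumr_eq0P _ _ D G) => // [k _|]; first by rewrite subr_ge0 Pvalid.
by rewrite sumrB -dot_suml hx subrr.
Qed.

(** At a vertex that maximizes the functional among the vertices, no edge is
    increasing, so by [edge_coordinates] the vertex maximizes it on P and the
    face consists of the points with zero coordinate along each edge that is
    strictly decreasing. *)
Lemma face_cface F : faces P F -> F = set0 \/ exists sigma, F = cface sigma.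
Proof.
move=> /faces_dot[a [t [valid ->]]]; set F' := P `&` _.
have [->|/set0P[x [Px /= ax]]] := eqVneq F' set0; first by left.
right.
pose e := [arg max_(e > finset.set0) dot a (V e)]%O.
have emax e' : dot a (V e') <= dot a (V e).
  by rewrite /e; case: arg_maxP => // k _ /(_ e' isT).
have edge_le0 i : dot a (edge e i) <= 0 by rewrite dotBr subr_le0.
have dota y : P y -> exists2 u : 'I_n -> R,
    dot a y = dot a (V e) + \sum_i u i * dot a (edge e i) &
    forall i, 0 <= u i /\ (u i = 0 <-> dot (c i (i \in e)) y = b i (i \in e)).
  move=> /(edge_coordinates e)[u [-> u0 ut]]; exists u => //.
  by rewrite dotDr dot_sumr; congr (_ + _); apply: eq_bigr => i _; rewrite dotZr.
have term_le0 (u : 'I_n -> R) i : 0 <= u i -> u i * dot a (edge e i) <= 0.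
  by move=> ui; rewrite mulr_ge0_le0.
have te : dot a (V e) = t.
  apply/le_anti; rewrite valid //=.
  have [u axu hu] := dota x Px; rewrite -[leLHS]ax axu.
  by rewrite gerDl sumr_le0 // => i _; apply: term_le0; case: (hu i).
exists (fun i => if dot a (edge e i) == 0 then None else Some (i \in e)).
apply/seteqP; split=> y [Py hy]; split=> //.
  move=> i s; case: eqP => // /eqP ai [<-].
  have [u ay hu] := dota y Py; apply/(hu i).2.
  rewrite /= ay te in hy.
  pose G k := - (u k * dot a (edge e k)).
  have /eqP : G i = 0.
    apply: (@psumr_eq0P _ _ predT G) => // [k _|].
      by rewrite oppr_ge0 term_le0 //; case: (hu k).
    by rewrite sumrN; apply/eqP; rewrite oppr_eq0 -(inj_eq (addrI t)) hy addr0.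
  by rewrite oppr_eq0 mulf_eq0 (negPf ai) orbF => /eqP.
rewrite /=; have [u -> hu] := dota y Py.
rewrite te big1 ?addr0 // => i _; case: (eqVneq (dot a (edge e i)) 0) => [->|ai].
  by rewrite mulr0.
have /(hu i).2 -> : dot (c i (i \in e)) y = b i (i \in e); last by rewrite mul0r.
by apply: hy; rewrite (negPf ai).
Qed.

Lemma cface_cubical : cubical_faces P cface.
Proof.
split; first exact: face_cface.
- by move=> sigma; split; [apply: cface_face|apply: cface_neq0].
- exact: cface_sub.
Qed.

End CubicalPolytope.

Lemma faces_set0 {R : realType} {d : nat} (P : set 'rV[R]_d) : faces P set0.
Proof.
apply/faces_dot; exists 0, 1; have dot0 x : dot (0 : 'rV[R]_d) x = 0.
  by rewrite /dot big1 // => i _; rewrite mxE mul0r.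
split=> [x _|]; first by rewrite dot0.
by apply/esym/seteqP; split=> // x [_ /=]; rewrite dot0 => /esym/eqP; rewrite oner_eq0.
Qed.

(** The faces of both polytopes are matched through their common index; the
    inclusion criterion makes this independent of the chosen index. *)
Lemma cubical_faces_equiv {R : realType} (d e n : nat)
    (P : set 'rV[R]_d) (Q : set 'rV[R]_e) faceP faceQ :
  cubical_faces (n := n) P faceP -> cubical_faces (n := n) Q faceQ ->
  comb_equiv P Q.
Proof.
move=> [Psub Pf Ple] [Qsub Qf Qle].
have [f [f0 fP]] : exists f : set 'rV[R]_d -> set 'rV[R]_e,
    f set0 = set0 /\ forall sigma, f (faceP sigma) = faceQ sigma.
  have fex F : exists G, (F = set0 -> G = set0) /\
      forall sigma, F = faceP sigma -> G = faceQ sigma.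
    have [->|F0] := eqVneq F set0.
      by exists set0; split=> // sigma /esym s0; have [_] := Pf sigma; rewrite s0 => -[].
    have [[sigma Fs]|nF] := pselect (exists sigma, F = faceP sigma).
      exists (faceQ sigma); split=> [/eqP|tau]; first by rewrite (negPf F0).
      rewrite Fs => st; apply/seteqP; split; apply/Qle; apply/Ple; rewrite st //.
    exists set0; split=> // sigma Fs; case: nF; by exists sigma.
  have [f hf] := choice fex.
  exists f; split; first exact: (hf set0).1.
  by move=> sigma; apply: (hf _).2.
have fle F G : faces P F -> faces P G -> (F `<=` G <-> f F `<=` f G).
  move=> /Psub[->|[sigma ->]] /Psub[->|[tau ->]]; rewrite ?f0 ?fP //.
  - by split=> _; apply: sub0set.
  - by split=> _; apply: sub0set.
  - have [[_ [x Px]] [_ [y Qy]]] := (Pf sigma, Qf sigma).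
    by split=> [/(_ x Px)|/(_ y Qy)].
  - exact: iff_trans (Ple _ _) (iff_sym (Qle _ _)).
exists f; split=> //; split.
- move=> F /= /Psub[->|[sigma ->]]; rewrite ?f0 ?fP; first exact: faces_set0.
  by case: (Qf sigma).
- move=> F G /set_mem PF /set_mem PG fFG.
  by apply/seteqP; split; apply/fle; rewrite // fFG.
- move=> G /= /Qsub[->|[sigma ->]].
    by exists set0 => //; apply: faces_set0.
  by exists (faceP sigma) => //; case: (Pf sigma).
Qed.

Lemma dot_convex_hull {R : realType} (d : nat) (A : set 'rV[R]_d) c t :
  (forall x, A x -> dot c x <= t) ->
  forall x, convex_hull A x -> dot c x <= t.
Proof.
move=> At; pose H := [set x | dot c x <= t].
apply: (@smallest_sub _ (@convex_set R 'rV[R]_d) A H) => // x y p.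
rewrite !inE /H /= => hx hy.
have -> : conv p x y = p%:num *: (x : 'rV_d) + (1 - p%:num) *: (y : 'rV_d) by [].
rewrite dotDr !dotZr -[t]mul1r -[X in _ <= X * t](subrKC p%:num) [leRHS]mulrDl.
by rewrite lerD ?ler_wpM2l ?subr_ge0 ?ge0 ?le1.
Qed.

Lemma cube_cubical {R : realType} n :
  exists face, cubical_faces (n := n) (cube R n) face.
Proof.
pose V (e : {set 'I_n}) : 'rV[R]_n := \row_i (i \in e)%:R.
pose c (i : 'I_n) (s : bool) : 'rV[R]_n := if s then delta_mx 0 i else - delta_mx 0 i.
pose b (i : 'I_n) (s : bool) : R := s%:R.
have V_in e : cube R n (V e) by move=> i; rewrite mxE ler0n lern1 leq_b1.
have valid i s x : cube R n x -> dot (c i s) x <= b i s.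
  by move=> /(_ i)/andP[x0 x1]; case: s; rewrite /b /= ?dotNl dot_delta ?oppr_le0.
have tight i s (e : {set 'I_n}) : dot (c i s) (V e) = b i s <-> (i \in e) = s.
  rewrite /b; case: s; rewrite /= ?dotNl dot_delta mxE;
    case: (i \in e); rewrite ?oppr0 /=; split=> // /eqP;
    by rewrite ?oppr_eq0 ?oner_eq0 // eq_sym oner_eq0.
have dirs x y : cube R n x -> cube R n y -> (x - y <= (1%:M : 'M[R]_n))%MS.
  by move=> _ _; apply: submx1.
have rk : (\rank (1%:M : 'M[R]_n) <= n)%N by rewrite mxrank1.
exists (cface (cube R n) c b); exact: (cface_cubical V_in valid tight dirs rk).
Qed.

(** * The Bruhat interval polytope *)

Lemma dot_perm_point {R : realType} n (z : 'S_n.+1) (a b : nat) :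
  dot (\row_k (a <= k < b)%N%:R) (perm_point R z) =
    (block_sum z a b + \sum_(k < n.+1 | (a <= k < b)%N) 1)%:R.
Proof.
rewrite /dot /block_sum -big_split natr_sum [RHS]big_mkcond /=.
by apply: eq_bigr => k _; rewrite !mxE addn1; case: ifP; rewrite ?mul1r ?mul0r.
Qed.

(** The coordinates of every point of the polytope have the same sum, so its
    directions lie in a space of dimension n. *)
Lemma polytope_cubical {R : realType} n (v w : 'S_n.+1) :
  v ord0 = ord0 -> w ord_max = ord0 ->
  (forall p : 'I_n, w (widen_ord (leqnSn n) p) = v (lift ord0 p)) ->
  exists face, cubical_faces (n := n) (bruhat_polytope R v w) face.
Proof.
move=> vmin wmax wv; pose pos (i : 'I_n) := widen_ord (leqnSn n) i.
have pos_max i : pos i != ord_max by rewrite -val_eqE /= ltn_eqF.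
have posI : injective pos by move=> i j /(congr1 val) /= ?; apply: val_inj.
pose V (e : {set 'I_n}) := perm_point R (vertex w (pos @: e)%SET).
pose lo (i : 'I_n) (s : bool) := if s then (pos i).+1 else block_start w (pos i).
pose hi (i : 'I_n) (s : bool) := if s then (next_smaller w (pos i)).+1 else (pos i).+1.
pose top (s : bool) := if s then v else w.
pose c i s : 'rV[R]_n.+1 := \row_k (lo i s <= k < hi i s)%N%:R.
pose b i s : R := dot (c i s) (perm_point R (top s)).
have V_in e : bruhat_polytope R v w (V e).
  apply: sub_gen_smallest; exists (vertex w (pos @: e)%SET) => //=.
  rewrite inE; apply: vertex_interval => //.
  by apply/fintype.subsetP => _ /imsetP[i _ ->]; rewrite inE.
have valid i s x : bruhat_polytope R v w x -> dot (c i s) x <= b i s.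
  move=> Px; apply: (dot_convex_hull _ Px) => _ [z /= zvw <-].
  move: zvw; rewrite inE => /andP[vz zw].
  rewrite /b !dot_perm_point ler_nat leq_add2r.
  case: s; rewrite /lo /hi /top; first exact: (shifted_block_sum_valid vmin wmax wv).
  exact: (block_sum_valid vmin wmax wv).
have tight i s (e : {set 'I_n}) : dot (c i s) (V e) = b i s <-> (i \in e) = s.
  have -> : (i \in e) = (pos i \in (pos @: e)%SET) by rewrite mem_imset.
  have -> : (dot (c i s) (V e) = b i s) <->
      (block_sum (vertex w (pos @: e)%SET) (lo i s) (hi i s) ==
         block_sum (top s) (lo i s) (hi i s)).
    rewrite /b !dot_perm_point.
    rewrite -(eqn_add2r (\sum_(k < n.+1 | (lo i s <= k < hi i s)%N) 1)).
    by rewrite -(eqr_nat R); split=> /eqP.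
  case: s; rewrite /lo /hi /top; first by rewrite (vertex_shifted_block_sum vmin wmax wv).
  by rewrite (vertex_block_sum wmax) //; split=> [/negPf|->].
pose J : 'cV[R]_n.+1 := const_mx 1.
have sumJ x : bruhat_polytope R v w x ->
    dot (const_mx 1) x = dot (const_mx 1) (perm_point R w).
  have dz (z : 'S_n.+1) :
      dot (const_mx 1) (perm_point R z) = dot (const_mx 1) (perm_point R w).
    rewrite /dot (reindex_inj (@perm_inj _ (z^-1)%g)).
    rewrite [RHS](reindex_inj (@perm_inj _ (w^-1)%g)).
    by apply: eq_bigr => k _; rewrite !mxE !permKV.
  move=> Px; apply/le_anti/andP; split.
    by apply: (dot_convex_hull _ Px) => _ [z _ <-]; rewrite dz.
  rewrite -lerN2 -!dotNl; apply: (dot_convex_hull _ Px) => _ [z _ <-].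
  by rewrite !dotNl dz.
have dirs x y : bruhat_polytope R v w x -> bruhat_polytope R v w y ->
    (x - y <= kermx J)%MS.
  move=> /sumJ sx /sumJ sy; apply/sub_kermxP/rowP => k; rewrite ord1 mxE [RHS]mxE.
  transitivity (dot (const_mx 1) (x - y)); last by rewrite dotBr sx sy subrr.
  by apply: eq_bigr => l _; rewrite !mxE mul1r mulr1.
have rk : (\rank (kermx J) <= n)%N.
  rewrite mxrank_ker leq_subLR -[leqLHS]addn1 addnC leq_add2r lt0n mxrank_eq0.
  by apply/eqP => /matrixP/(_ ord0 ord0)/eqP; rewrite !mxE oner_eq0.
exists (cface (bruhat_polytope R v w) c b).
exact: (cface_cubical V_in valid tight dirs rk).
Qed.

Theorem proposition8p3 (R : realType) (n : nat) (v w : 'S_n.+1)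
  (hw : w = pmul v (\big[@pmul n.+1/1%g]_(i < n) simple_transp i))
  (hl : ((perm_length w)%:Z - (perm_length v)%:Z = n%:Z)%R) :
  (forall i j : 'I_n.+1, (i < j)%N ->
     (pmul w (tperm i j) \in coatoms v w) <->
     (w j < w i)%N /\
     (forall p : 'I_n.+1, (i < p)%N -> (p < j)%N -> (w i < w p)%N)) /\
  #|coatoms v w| = n /\
  comb_equiv (bruhat_polytope R v w) (cube R n).
Proof.
have wv (p : 'I_n) : w (widen_ord (leqnSn n) p) = v (lift ord0 p).
  rewrite hw pmulE; congr (v _); apply: val_inj.
  by rewrite /= bigpmul_simple_transp -val_eqE /= ltn_eqF.
have wmax_v : w ord_max = v ord0.
  by rewrite hw pmulE; congr (v _); apply: val_inj; rewrite /= bigpmul_simple_transp eqxx.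
have vmin : v ord0 = ord0.
  apply: (first_value_min wv wmax_v); apply/eqP; rewrite -!perm_lengthE.
  by rewrite -eqz_nat PoszD -hl subrKC.
have wmax : w ord_max = ord0 by rewrite wmax_v.
split; [|split]; last first.
- have [faceP hP] := @polytope_cubical R n v w vmin wmax wv.
  have [faceQ hQ] := @cube_cubical R n.
  exact: cubical_faces_equiv hP hQ.
- exact: card_coatoms.
move=> i j ij; split=> [|[]]; last exact: next_smaller_coatom.
rewrite !inE => /andP[/andP[vz zw] _]; exact: interval_tperm_between ij vz zw.
Qed.
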